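(* Let $n>1$ be an odd integer and let $r\geqslant 1$. Then, modulo $[n^r]\prod_{j=1}^r\Phi_{n^j}(q)^2$, \begin{align*} \sum_{k=0}^{(n^r-1)/2}[4k+1]\frac{(q;q^2)_k^4} {(q^2;q^2)_k^4} &\equiv q^{(1-n)/2} [n] \sum_{k=0}^{(n^{r-1}-1)/2}[4k+1]_{q^n}\frac{(q^{n};q^{2n})_k^4} {(q^{2n};q^{2n})_k^4},\\ \sum_{k=0}^{n^r-1}[4k+1]\frac{(q;q^2)_k^4} {(q^2;q^2)_k^4} &\equiv q^{(1-n)/2} [n] \sum_{k=0}^{n^{r-1}-1}[4k+1]_{q^n}\frac{(q^{n};q^{2n})_k^4} {(q^{2n};q^{2n})_k^4}. \end{align*}
   Context: Notation: $(a;q)_k=(1-a)(1-aq)\cdots(1-aq^{k-1})$ (with $(a;q)_0=1$) is the $q$-shifted factorial; $[m]=[m]_q=1+q+\cdots+q^{m-1}$ is the $q$-integer, and $[m]_{q^n}=1+q^n+\cdots+q^{n(m-1)}$. $\Phi_m(q)$ denotes the $m$-th cyclotomic polynomial in $q$. For rational functions $A(q),B(q)$ and a polynomial $P(q)$, $A\equiv B\pmod{P}$ means that $A-B$ can be written as a quotient of polynomials whose numerator is divisible by $P(q)$ and whose denominator is relatively prime to $P(q)$. *)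

(* Defs.v *)
From HB Require Import structures.
From mathcomp Require Import all_boot all_order all_algebra all_field.
Set Implicit Arguments. Unset Strict Implicit. Unset Printing Implicit Defensive.
Import GRing.Theory.
Local Open Scope ring_scope.

Definition RF := {fraction {poly rat}}.

Definition polyF (p : {poly rat}) : RF := tofrac p.

Definition qq : RF := polyF 'X.

Definition qpoch (a b : RF) (k : nat) : RF := \prod_(i < k) (1 - a * b ^+ i).

Definition qint (x : RF) (m : nat) : RF := \sum_(i < m) x ^+ i.

Definition qintP (m : nat) : {poly rat} := \sum_(i < m) 'X ^+ i.

Definition PhiQ (m : nat) : {poly rat} := map_poly intr ('Phi_m).

Definition qcongr (A B : RF) (P : {poly rat}) : Prop :=
  exists (N D : {poly rat}),
    [/\ D != 0, coprimep D P, P %| N & A - B = polyF N / polyF D].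

(* Main.v *)
Require Import Defs.
From HB Require Import structures.
From mathcomp Require Import all_boot all_order all_algebra all_field.
From mathcomp Require Import ring zify.
Import Order.TTheory GRing.Theory Num.Theory.
Local Open Scope ring_scope.

(** Put [P_u(y) = 1 + u^2 - u y], so that [P_u(x + 1/x) = (1 - u x)(1 - u / x)] and [P_u(2) =
(1 - u)^2], and [rho_k(y) = \prod_(i < k) P_(q^(2i+1))(y) / P_(q^(2i+2))(y)].  The summand of
the theorem is the value at [y = 2] of [[4k+1] rho_k(2) rho_k(y)].  Let [D(y)] be the
difference of the two sides of the congruence after this deformation (with [q^n] in place of
[q] on the right).

At [y = q^m + q^(-m)], [m = 2M+1], the sum terminates, with value [q^(-M) [m]] (a terminating
6phi5, proved here by a WZ pair).  Hence [D] vanishes at all the points coming from the odd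
multiples [m = (2j+1) n], which are as many as the terms of the sum on the right.

At a primitive [d]-th root of unity, [d > 1] dividing [n^r], the terms [k] and [(d-1)/2 - k]
cancel, the terms with [(d-1)/2 < k < d] vanish, and blocks of [d] consecutive terms are
proportional to the first one, so both sides of [D(c)] vanish there for [c = 2] and for every
integer [c > 2].

For [d = n^t], clear the denominators of [D(y)].  The resulting polynomial in [y] reduces to
[0] at the root of unity, as it does so for infinitely many [c]; dividing it by the [y - (q^m +
q^(-m))] leaves a polynomial that still reduces to [0].  At [y = 2] the divided factors become
[-(1 - q^m)^2 / q^m], and there is one more multiple of [d] among the [m] than among the
exponents of the factors [(1 - q^(2i+2))^2] of the denominator: this gives divisibility by
[Phi_d^3]. *)

(** * The deformed summand *)

(* [P_u(y)] in the notation above. *)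
Definition wpf {F : fieldType} (y u : F) : F := 1 + u ^+ 2 - u * y.
Definition rho {F : fieldType} (y x : F) (k : nat) : F :=
  \prod_(i < k) (wpf y (x ^+ (2 * i).+1) / wpf y (x ^+ (2 * i).+2)).
Definition geo {F : fieldType} (x : F) (m : nat) : F := \sum_(i < m) x ^+ i.
Definition wpsum {F : fieldType} (y x : F) (K : nat) : F :=
  \sum_(k < K) geo x (4 * k).+1 * (rho 2 x k * rho y x k).

Lemma geoM1 {F : fieldType} (x : F) m : (1 - x) * geo x m = 1 - x ^+ m.
Proof.
rewrite -opprB mulNr -[X in _ = X]opprB subrX1; congr (- (_ * _)).
Qed.

Lemma rhoS {F : fieldType} (y x : F) k :
  rho y x k.+1 = rho y x k * (wpf y (x ^+ (2 * k).+1) / wpf y (x ^+ (2 * k).+2)).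
Proof. by rewrite /rho big_ord_recr. Qed.

Lemma rho0 {F : fieldType} (y x : F) : rho y x 0 = 1.
Proof. by rewrite /rho big_ord0. Qed.

Lemma wpf2 {F : fieldType} (u : F) : wpf 2 u = (1 - u) ^+ 2.
Proof. rewrite /wpf; ring. Qed.

Lemma wpf_node {F : fieldType} (u v : F) : v != 0 ->
  wpf (v + v^-1) u = (1 - u * v) * (v - u) / v.
Proof. move=> v0; rewrite /wpf; field; exact: v0. Qed.

(** Discharges the side conditions of [field]: each is a hypothesis up to [ring] and sign. *)
Ltac nz := repeat (apply/andP; split);
  first [ assumption
  | match goal with H : is_true (?X != 0) |- is_true (?Y != 0) =>
      have -> : Y = X by [ring]; exact H end
  | match goal with H : is_true (?X != 0) |- is_true (?Y != 0) =>
      have -> : Y = - X by [ring]; rewrite oppr_eq0; exact H end ].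

(** * Evaluation of the terminating sum by a WZ pair *)

Section WZ.
Context {F : fieldType} (q : F).
Hypothesis q0 : q != 0.
Hypothesis qX1 : forall m, (0 < m)%N -> q ^+ m != 1.

Let node M : F := q ^+ (2 * M).+1 + (q ^+ (2 * M).+1)^-1.
Let tm M k : F := rho 2 q k * rho (node M) q k.
(** [(1 - q) * w M] is the inverse of the expected value [q^(-M) [2M+1]], so the normalised terms
    [G M k] below should add up to 1. *)
Let w M : F := q ^+ M / (1 - q ^+ (2 * M).+1).

Lemma qX1' m : (0 < m)%N -> 1 - q ^+ m != 0.
Proof. by move=> m0; rewrite subr_eq0 eq_sym qX1. Qed.

Lemma qX_sub a b : a != b -> q ^+ a - q ^+ b != 0.
Proof.
wlog lt: a b / (a < b)%N => [H|_].
  rewrite neq_ltn => /orP[] l; first by apply: H => //; rewrite neq_ltn l.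
  by rewrite -opprB oppr_eq0 H // neq_ltn l.
have -> : b = (a + (b - a))%N by lia.
rewrite exprD -{1}[q ^+ a]mulr1 -mulrBr mulf_neq0 ?expf_neq0 //.
by apply: qX1'; lia.
Qed.

(** The factor [B - A] vanishes at [k = M], which terminates the sum. [B - q * A] never vanishes,
    its exponents having opposite parity. *)
Lemma tmS M k : let A := q ^+ (2 * k) in let B := q ^+ (2 * M) in
  tm M k.+1 = tm M k * ((1 - q * A) ^+ 2 * (1 - q ^+ 2 * A * B) * (B - A) /
      ((1 - q ^+ 2 * A) ^+ 2 * (1 - q ^+ 3 * A * B) * (B - q * A))).
Proof.
move=> A B; rewrite /tm !rhoS !wpf2 /node !wpf_node ?expf_neq0 //.
have -> : q ^+ (2 * k).+1 = q * A by rewrite exprS.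
have -> : q ^+ (2 * k).+2 = q ^+ 2 * A by rewrite -addn2 addnC exprD.
have -> : q ^+ (2 * M).+1 = q * B by rewrite exprS.
have B0 : B != 0 by rewrite expf_neq0.
have [] : [/\ 1 - q ^+ 2 * A != 0, 1 - q ^+ 3 * A * B != 0 & B - q * A != 0].
  split.
  - by rewrite -exprD qX1'.
  - by rewrite -!exprD qX1'.
  - by rewrite -exprS qX_sub //; lia.
move=> h1 h2 h3.
field.
have h4 : q * B - q ^+ 2 * A != 0 by rewrite expr2 -mulrA -mulrBr mulf_neq0.
nz.
Qed.

(** The term ratio in the direction of [M]. The bound on [k] keeps [q^2 B - A] nonzero. *)
Lemma tm_up M k : (k <= M)%N -> let A := q ^+ (2 * k) in let B := q ^+ (2 * M) in
  tm M.+1 k = tm M k * ((1 - q ^+ 2 * A * B) * (1 - q ^+ 3 * B) * (q * B - A) /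
     ((q ^+ 2 * B - A) * (1 - q ^+ 3 * A * B) * (1 - q * B))).
Proof.
elim: k => [|k IH] lek A B.
  rewrite /tm !rho0 /A muln0 expr0.
  field.
  have e1 : 1 - q ^+ 3 * B != 0 by rewrite -exprD qX1'.
  have e2 : 1 - q ^+ 1 * B != 0 by rewrite -exprD qX1'.
  have e3 : 1 - q ^+ 2 * B != 0 by rewrite -exprD qX1'.
  by nz.
rewrite !tmS IH 1?ltnW //.
set A' := q ^+ (2 * k).
have -> : A = q ^+ 2 * A' by rewrite /A mulnS exprD.
have -> : q ^+ (2 * M.+1) = q ^+ 2 * B by rewrite mulnS exprD.
rewrite -/B; field.
have B0 : B != 0 by rewrite expf_neq0.
have e1 : B - q * A' != 0 by rewrite -exprS qX_sub //; lia.
have e2 : B - A' != 0 by rewrite qX_sub //; lia.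
have e3 : 1 - q * B != 0 by rewrite -exprS qX1'.
have e4 : 1 - q ^+ 3 * A' * B != 0 by rewrite -!exprD qX1'.
have e5 : 1 - q ^+ 5 * A' * B != 0 by rewrite -!exprD qX1'.
have e6 : 1 - q ^+ 2 * A' != 0 by rewrite -exprD qX1'.
have e7 : q * B - A' != 0 by rewrite -exprS qX_sub //; lia.
have e8 : q ^+ 2 * B - A' != 0 by rewrite -exprD qX_sub //; lia.
have e9 : q ^+ 2 * B - q * A' != 0 by rewrite expr2 -mulrA -mulrBr mulf_neq0.
have e10 : q ^+ 2 * B - q ^+ 2 * A' != 0 by rewrite -mulrBr mulf_neq0 ?expf_neq0.
nz.
Qed.

Let G M k : F := w M * (1 - q ^+ (4 * k).+1) * tm M k.

(* The last factor is the WZ certificate, in terms of [A = q^(2k)] and [B = q^(2M)]. *)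
Lemma wz_partial M k : (k <= M)%N -> let A := q ^+ (2 * k) in let B := q ^+ (2 * M) in
  \sum_(i < k.+1) (G M.+1 i - G M i) =
  w M * tm M k * ((1 + q ^+ 2 * B) * (1 - q * A) ^+ 2 * (1 - q ^+ 2 * A * B) /
     ((1 - q ^+ 3 * A * B) * (q ^+ 2 * B - 1))).
Proof.
have Mw : forall B : F, B = q ^+ (2 * M) -> w M.+1 = w M * (q * (1 - q * B) / (1 - q ^+ 3 * B)).
  move=> B BE; rewrite /w exprS.
  have -> : q ^+ (2 * M).+1 = q * B by rewrite exprS BE.
  have -> : q ^+ (2 * M.+1).+1 = q ^+ 3 * B by rewrite BE -exprD; congr (_ ^+ _); lia.
  field.
  have e1 : 1 - q * B != 0 by rewrite BE -exprS qX1'.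
  have e2 : 1 - q ^+ 3 * B != 0 by rewrite BE -exprD qX1'.
  nz.
elim: k => [|k IH] lek A B.
  rewrite big_ord1 /G tm_up // muln0 expr1 (Mw B) //.
  rewrite /tm !rho0 /A muln0 expr0.
  have e1 : 1 - q ^+ 3 * B != 0 by rewrite -exprD qX1'.
  have e2 : 1 - q * B != 0 by rewrite -exprS qX1'.
  have e3 : q ^+ 2 * B - 1 != 0 by rewrite -opprB oppr_eq0 -exprD qX1'.
  field.
  nz.
rewrite big_ord_recr /= IH 1?ltnW // /G (Mw B) // tm_up // tmS.
set A' := q ^+ (2 * k).
rewrite -/A -/B.
have -> : q ^+ (4 * k.+1).+1 = q * A ^+ 2.
  by rewrite -exprM -exprS; congr (_ ^+ _); lia.
have -> : A = q ^+ 2 * A' by rewrite /A mulnS exprD.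
have B0 : B != 0 by rewrite expf_neq0.
have e1 : B - q * A' != 0 by rewrite -exprS qX_sub //; lia.
have e2 : B - A' != 0 by rewrite qX_sub //; lia.
have e3 : 1 - q * B != 0 by rewrite -exprS qX1'.
have e4 : 1 - q ^+ 3 * A' * B != 0 by rewrite -!exprD qX1'.
have e5 : 1 - q ^+ 5 * A' * B != 0 by rewrite -!exprD qX1'.
have e6 : 1 - q ^+ 2 * A' != 0 by rewrite -exprD qX1'.
have e8 : 1 - q ^+ 3 * B != 0 by rewrite -exprD qX1'.
have e9 : q ^+ 2 * B - 1 != 0 by rewrite -opprB oppr_eq0 -exprD qX1'.
field.
have e10 : q ^+ 2 * B - q ^+ 2 * A' != 0 by rewrite -mulrBr mulf_neq0 ?expf_neq0.
nz.
Qed.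

Lemma tm_gt M k : (M < k)%N -> tm M k = 0.
Proof.
move=> lt; rewrite -(subnK lt); elim: (k - _)%N => [|j IH].
  by rewrite add0n tmS subrr mulr0 mul0r mulr0.
by rewrite addSn tmS IH mul0r.
Qed.

(** Induction on [M]: by [wz_partial] at [k = M], the increments of the old terms add up to the
    opposite of the new term [G M.+1 M.+1]. *)
Lemma wz_sum M : \sum_(i < M.+1) G M i = 1.
Proof.
elim: M => [|M IH].
  rewrite big_ord1 /G /w /tm !rho0 expr1 expr0 !mulr1 mul1r mulVf //.
  exact: (qX1' 1).
rewrite big_ord_recr /=.
have -> : \sum_(i < M.+1) G M.+1 i = \sum_(i < M.+1) (G M.+1 i - G M i) + 1.
  by rewrite sumrB IH subrK.
rewrite wz_partial // addrAC.
rewrite /G tmS tm_up //.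
set B := q ^+ (2 * M).
have -> : q ^+ (4 * M.+1).+1 = q ^+ 5 * B ^+ 2.
  by rewrite -exprM -exprD; congr (_ ^+ _); lia.
rewrite /w [q ^+ M.+1]exprS.
have -> : q ^+ (2 * M).+1 = q * B by rewrite exprS.
have -> : q ^+ (2 * M.+1).+1 = q ^+ 3 * B.
  by rewrite -exprD; congr (_ ^+ _); lia.
have -> : q ^+ (2 * M.+1) = q ^+ 2 * B by rewrite mulnS exprD.
have B0 : B != 0 by rewrite expf_neq0.
have e1 : 1 - q * B != 0 by rewrite -exprS qX1'.
have e2 : 1 - q ^+ 3 * B != 0 by rewrite -exprD qX1'.
have e3 : q ^+ 2 * B - 1 != 0 by rewrite -opprB oppr_eq0 -exprD qX1'.
have e4 : 1 - q ^+ 3 * B * B != 0 by rewrite -!exprD qX1'.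
have e5 : 1 - q ^+ 5 * B * B != 0 by rewrite -!exprD qX1'.
have e6 : q ^+ 2 * B - q * B != 0 by rewrite -mulrBl mulf_neq0 // -{2}[q]expr1 qX_sub.
have e7 : q ^+ 2 * B - B != 0 by rewrite -[X in _ - X]mul1r -mulrBl mulf_neq0 // -(expr0 q) qX_sub.
have e8 : 1 - q ^+ 2 * B != 0 by rewrite -exprD qX1'.
rewrite -/B.
suff: forall x y : F, x = - y -> x + y + 1 = 1 by move=> H; apply: H; field; nz.
by move=> x y ->; rewrite addNr add0r.
Qed.

Lemma wpsum_node M K : (M <= K)%N ->
  wpsum (node M) q K.+1 = q ^- M * geo q (2 * M).+1.
Proof.
move=> leMK.
have q1 : 1 - q != 0 by rewrite -[q]expr1 qX1'.
have -> : wpsum (node M) q K.+1 = wpsum (node M) q M.+1.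
  rewrite -(subnK leMK); elim: (K - M)%N => // j IH.
  by rewrite addSn {1}/wpsum big_ord_recr /= -/(tm _ _) tm_gt ?mulr0 ?addr0 //; lia.
have h : 1 - q ^+ (2 * M).+1 != 0 by rewrite qX1'.
(* The multiplier is [w M * (1 - q)]: it turns the right side into 1 and the left side into the sum
   of [wz_sum]. *)
apply: (mulfI (mulf_neq0 (expf_neq0 M q0) (mulf_neq0 (invr_neq0 h) q1))).
have -> : geo q (2 * M).+1 = (1 - q ^+ (2 * M).+1) / (1 - q).
  by rewrite -geoM1 mulrC mulKf.
transitivity (1 : F); last first.
  by field; rewrite expf_neq0 // h q1.
rewrite -[RHS](wz_sum M) /wpsum mulr_sumr; apply: eq_bigr => k _.
by rewrite /G -(geoM1 q (4 * k).+1) /w /tm; ring.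
Qed.

End WZ.

(** * Cancellation at a root of unity of odd order *)

Section Residue.
Context {F : fieldType} (z y : F) (M : nat).
Let g := (2 * M).+1.
Hypothesis M0 : (0 < M)%N.
Hypothesis zg : z ^+ g = 1.
Hypothesis wnz : forall m, ~~ (g %| m)%N -> wpf y (z ^+ m) != 0.

Let z0 : z != 0.
Proof. by apply: contra_eq_neq zg => ->; rewrite expr0n eq_sym oner_eq0. Qed.

Lemma wpfV u : u != 0 -> wpf y u^-1 = wpf y u / u ^+ 2.
Proof. by move=> u0; rewrite /wpf; field. Qed.

Lemma zXV a b : (a + b = g)%N -> z ^+ a = (z ^+ b)^-1.
Proof.
move=> ab; apply: (mulIf (expf_neq0 b z0)).
by rewrite -exprD ab zg mulVf // expf_neq0.
Qed.

Let nd1 i : (i < M)%N -> wpf y (z ^+ (2 * i).+1) != 0.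
Proof. by move=> iM; apply: wnz; rewrite gtnNdvd // /g; lia. Qed.
Let nd2 i : (i < M)%N -> wpf y (z ^+ (2 * i).+2) != 0.
Proof. by move=> iM; apply: wnz; rewrite gtnNdvd // /g; lia. Qed.

(** Reversing the denominators pairs the exponent [2i+1] above with [g - (2i+1)] below. By [wpfV]
    the quotient is [z^(2(2i+1))], and the odd numbers below [2M] add up to [M^2]. *)
Lemma rho_half : rho y z M = z ^+ (2 * M * M).
Proof.
rewrite /rho prodf_div [X in _ / X](reindex_inj rev_ord_inj) /= -prodf_div.
transitivity (\prod_(i < M) z ^+ (2 * (2 * i).+1)).
  apply: eq_bigr => -[i iM] _ /=.
  have -> : z ^+ (2 * (M - i.+1)).+2 = (z ^+ (2 * i).+1)^-1.
    by apply: zXV; rewrite /g; lia.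
  rewrite wpfV ?expf_neq0 // invfM invrK mulrA mulfV ?nd1 // mul1r.
  by rewrite -exprM mulnC.
rewrite prodrXr; congr (_ ^+ _).
by elim: M => [|m IH]; rewrite ?big_ord0 // big_ord_recr /= IH; lia.
Qed.

(** By [wpfV], the factor of index [M-k-1] is [z^(-2)] times the inverse of the factor of index
    [k]. *)
Lemma rho_rev k : (k <= M)%N ->
  rho y z (M - k) = z ^+ (2 * k) * rho y z k * rho y z M.
Proof.
elim: k => [|k IH] kM; first by rewrite subn0 rho0 muln0 expr0 !mul1r.
have := IH (ltnW kM); have -> : (M - k = (M - k.+1).+1)%N by lia.
rewrite !rhoS.
have -> : z ^+ (2 * (M - k.+1)).+1 = (z ^+ (2 * k).+2)^-1.
  by apply: zXV; rewrite /g; lia.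
have -> : z ^+ (2 * (M - k.+1)).+2 = (z ^+ (2 * k).+1)^-1.
  by apply: zXV; rewrite /g; lia.
rewrite !wpfV ?expf_neq0 //.
have := nd1 _ kM; have := nd2 _ kM.
have -> : z ^+ (2 * k.+1) = z ^+ 2 * z ^+ (2 * k) by rewrite mulnS exprD.
rewrite [z ^+ (2 * k).+2]exprS [z ^+ (2 * k).+1]exprS.
set u := z ^+ (2 * k).
set a := wpf y (z * u).
set b := wpf y _ => bn an.
have u0 : u != 0 by rewrite expf_neq0.

set R1 := rho y z (M - k.+1); move=> H.
transitivity (z ^+ 2 * (a / b) * (u * rho y z k * rho y z M)); last by ring.
rewrite -H; field.
by nz.
Qed.

End Residue.

Lemma residue_sum {F : fieldType} (z y : F) (M : nat) : (0 < M)%N ->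
  z ^+ (2 * M).+1 = 1 -> (2 : F) != 0 ->
  (forall m, ~~ ((2 * M).+1 %| m)%N -> z ^+ m != 1) ->
  (forall m, ~~ ((2 * M).+1 %| m)%N -> wpf y (z ^+ m) != 0) ->
  wpsum y z M.+1 = 0.
Proof.
move=> M0 zg n2 zn1 wnz.
have z1 : 1 - z != 0.
  by rewrite subr_eq0 eq_sym -[z]expr1 zn1 // gtnNdvd //; lia.
have w2 m : ~~ ((2 * M).+1 %| m)%N -> wpf 2 (z ^+ m) != 0.
  by move=> h; rewrite wpf2 expf_neq0 // subr_eq0 eq_sym zn1.
set T := fun k => geo z (4 * k).+1 * (rho 2 z k * rho y z k).
have T_rev k : (k <= M)%N -> T (M - k)%N = - T k.
  move=> kM; rewrite /T (rho_rev z 2 M) // (rho_rev z y M) //.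
  rewrite (rho_half z 2 M) // (rho_half z y M) //; apply: (mulfI z1).
  rewrite /= [LHS]mulrA geoM1.
  (* Modulo [g = 2M+1], [4M^2] is 1 and [4(M-k)+1] is opposite to [4k+1]. So the powers from
     [rho_rev] and [rho_half] combine to [z^(4k+1)], and [z^(4(M-k)+1) z^(4k+1) = 1] yields the
     sign. *)
  have e : z ^+ (4 * (M - k)).+1 * (z ^+ (2 * k) * z ^+ (2 * k) *
     (z ^+ (2 * M * M) * z ^+ (2 * M * M))) = 1.
    rewrite -!exprD.
    have -> : ((4 * (M - k)).+1 + (2 * k + 2 * k + (2 * M * M + 2 * M * M)) =
      (2 * M).+1 * (2 * M).+1)%N by nia.
    by rewrite exprM zg expr1n.
  have e' : z ^+ (2 * k) * z ^+ (2 * k) * (z ^+ (2 * M * M) * z ^+ (2 * M * M)) =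
      z ^+ (4 * k).+1.
    rewrite -!exprD.
    have -> : (2 * k + 2 * k + (2 * M * M + 2 * M * M) =
       (4 * k).+1 + (2 * M).+1 * (2 * M).-1)%N by nia.
    by rewrite exprD exprM zg expr1n mulr1.
  rewrite e' in e.
  transitivity ((1 - z ^+ (4 * (M - k)).+1) * z ^+ (4 * k).+1 * (rho 2 z k * rho y z k)).
    by rewrite -e'; ring.
  rewrite mulrBl e mul1r mulrN [(1 - z) * _]mulrA geoM1; ring.
have /eqP : wpsum y z M.+1 = - wpsum y z M.+1.
  rewrite {1}/wpsum (reindex_inj rev_ord_inj) /= /wpsum -sumrN.
  by apply: eq_bigr => -[i iM] _ /=; rewrite subSS -/(T _) T_rev.
by rewrite -addr_eq0 -mulr2n -mulr_natl mulf_eq0 (negbTE n2) => /eqP.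
Qed.

(** The factor of index [M] has numerator [wpf 2 1 = 0]: the undeformed half of the summand cuts the
    sum, for every [y]. *)
Lemma rho2_gt_half {F : fieldType} (z : F) M k : z ^+ (2 * M).+1 = 1 -> (M < k)%N ->
  rho 2 z k = 0.
Proof.
move=> zg lt; rewrite -(subnK lt); elim: (k - _)%N => [|j IH].
  by rewrite add0n rhoS wpf2 zg subrr expr0n mul0r mulr0.
by rewrite addSn rhoS IH mul0r.
Qed.

Lemma residue_sum_full {F : fieldType} (z y : F) (M k : nat) : 
  z ^+ (2 * M).+1 = 1 -> (M < k)%N -> wpsum y z k = wpsum y z M.+1.
Proof.
move=> zg lt; rewrite -(subnK lt); elim: (k - _)%N => [|j IH] //.
by rewrite addSn {1}/wpsum big_ord_recr /= (rho2_gt_half z M) ?mul0r ?mulr0 ?addr0 //; lia.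
Qed.

(** * Evaluation of rational functions at an algebraic number *)

Definition pev (z : algC) (p : {poly rat}) : algC := (map_poly ratr p).[z].

Lemma pevD z p q : pev z (p + q) = pev z p + pev z q.
Proof. by rewrite /pev rmorphD hornerD. Qed.
Lemma pevN z p : pev z (- p) = - pev z p.
Proof. by rewrite /pev rmorphN hornerN. Qed.
Lemma pevM z p q : pev z (p * q) = pev z p * pev z q.
Proof. by rewrite /pev rmorphM hornerM. Qed.
Lemma pev0 z : pev z 0 = 0.
Proof. by rewrite /pev rmorph0 horner0. Qed.
Lemma pev1 z : pev z 1 = 1.
Proof. by rewrite /pev rmorph1 hornerC. Qed.
Lemma pevX z : pev z 'X = z.
Proof. by rewrite /pev map_polyX hornerX. Qed.
Lemma polyFM p q : polyF (p * q) = polyF p * polyF q.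
Proof. exact: rmorphM. Qed.
Lemma polyFD p q : polyF (p + q) = polyF p + polyF q.
Proof. exact: rmorphD. Qed.
Lemma polyFN p : polyF (- p) = - polyF p.
Proof. exact: rmorphN. Qed.
Lemma polyF1 : polyF 1 = 1.
Proof. exact: rmorph1. Qed.
Lemma polyF_eq0 p : (polyF p == 0) = (p == 0).
Proof. exact: tofrac_eq0. Qed.

(** A relation, since [f] has a value only when some denominator does not vanish at [z]. At a
    primitive [d]-th root of unity, value 0 means a numerator divisible by [Phi_d]. *)
Definition evalsto (z : algC) (f : RF) (a : algC) : Prop :=
  exists N D : {poly rat},
    [/\ pev z D != 0, f = polyF N / polyF D & a = pev z N / pev z D].

Definition regular (z : algC) (f : RF) : Prop := exists a, evalsto z f a.

Lemma pev_neq0 z p : pev z p != 0 -> polyF p != 0.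
Proof. by rewrite polyF_eq0; apply: contraNneq => ->; rewrite pev0. Qed.

Section Place.
Variable z : algC.

Lemma ev_poly p : evalsto z (polyF p) (pev z p).
Proof.
by exists p, 1; rewrite pev1 oner_neq0 polyF1 !invr1 !mulr1.
Qed.

Lemma ev_uniq f a b : evalsto z f a -> evalsto z f b -> a = b.
Proof.
move=> [N [D [Dn -> ->]]] [N' [D' [Dn' /eqP E ->]]].
move: E; rewrite eqr_div ?(pev_neq0 z) // -!polyFM -subr_eq0 -polyFN -polyFD polyF_eq0.
rewrite subr_eq0 => /eqP E.
by apply/eqP; rewrite eqr_div // -!pevM E.
Qed.

Lemma evD f g a b : evalsto z f a -> evalsto z g b -> evalsto z (f + g) (a + b).
Proof.
move=> [N [D [Dn -> ->]]] [N' [D' [Dn' -> ->]]].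
exists (N * D' + N' * D), (D * D').
by rewrite !pevM !pevD !polyFM !polyFD !polyFM !addf_div ?(pev_neq0 z) // !pevM mulf_neq0.
Qed.

Lemma evN f a : evalsto z f a -> evalsto z (- f) (- a).
Proof.
move=> [N [D [Dn -> ->]]]; exists (- N), D.
by rewrite pevN polyFN !mulNr.
Qed.

Lemma evB f g a b : evalsto z f a -> evalsto z g b -> evalsto z (f - g) (a - b).
Proof. by move=> fa gb; apply: evD => //; apply: evN. Qed.

Lemma evM f g a b : evalsto z f a -> evalsto z g b -> evalsto z (f * g) (a * b).
Proof.
move=> [N [D [Dn -> ->]]] [N' [D' [Dn' -> ->]]].
exists (N * N'), (D * D').
by rewrite !pevM !polyFM !mulf_div mulf_neq0.
Qed.

Lemma evV f a : a != 0 -> evalsto z f a -> evalsto z f^-1 a^-1.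
Proof.
move=> a0 [N [D [Dn -> aE]]]; exists D, N.
rewrite aE !invf_div; split => //.
by apply: contraNneq a0; rewrite aE => ->; rewrite mul0r.
Qed.

Lemma ev_div f g a b : b != 0 -> evalsto z f a -> evalsto z g b ->
  evalsto z (f / g) (a / b).
Proof. by move=> b0 fa gb; apply: evM => //; apply: evV. Qed.

Lemma ev0 : evalsto z 0 0.
Proof. by have := ev_poly 0; rewrite pev0 /polyF tofrac0. Qed.

Lemma ev1 : evalsto z 1 1.
Proof. by have := ev_poly 1; rewrite pev1 polyF1. Qed.

Lemma ev_nat n : evalsto z n%:R n%:R.
Proof. by elim: n => [|n IH]; [exact: ev0|rewrite !mulrS; apply: evD => //; exact: ev1]. Qed.

Lemma evX f a n : evalsto z f a -> evalsto z (f ^+ n) (a ^+ n).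
Proof. by move=> fa; elim: n => [|n IH]; [exact: ev1|rewrite !exprS; apply: evM]. Qed.

Lemma ev_sum I (r : seq I) (P : pred I) F a :
  (forall i, P i -> evalsto z (F i) (a i)) ->
  evalsto z (\sum_(i <- r | P i) F i) (\sum_(i <- r | P i) a i).
Proof. by move=> H; apply: (big_ind2 (evalsto z) ev0) => // *; exact: evD. Qed.

Lemma ev_prod I (r : seq I) (P : pred I) F a :
  (forall i, P i -> evalsto z (F i) (a i)) ->
  evalsto z (\prod_(i <- r | P i) F i) (\prod_(i <- r | P i) a i).
Proof. by move=> H; apply: (big_ind2 (evalsto z) ev1) => // *; exact: evM. Qed.

Lemma ev_qX m : evalsto z (qq ^+ m) (z ^+ m).
Proof. by apply: evX; have := ev_poly 'X; rewrite pevX. Qed.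

Lemma ev_geo f a m : evalsto z f a -> evalsto z (geo f m) (geo a m).
Proof. by move=> fa; apply: ev_sum => i _; apply: evX. Qed.

Lemma ev_wpf y u b a : evalsto z y b -> evalsto z u a ->
  evalsto z (wpf y u) (wpf b a).
Proof. by move=> *; apply: evB; [apply: evD; [exact: ev1|apply: evX]|apply: evM]. Qed.

End Place.

Lemma qq_neq0 : qq != 0.
Proof. by rewrite /qq polyF_eq0 polyX_eq0. Qed.

Lemma qqX_neq1 m : (0 < m)%N -> qq ^+ m != 1.
Proof.
move=> m0; rewrite /qq /polyF -tofracXn -tofrac1 tofrac_eq.
apply/negP => /eqP /(congr1 (fun p : {poly rat} => size p)).
rewrite size_polyXn size_poly1; lia.
Qed.

Lemma geo1 {F : fieldType} m : geo (1 : F) m = m%:R.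
Proof.
rewrite /geo; under eq_bigr do rewrite expr1n.
by rewrite sumr_const card_ord.
Qed.

(** * Order of vanishing of products of [1 - q^m] *)

Section Root.
Variables (d : nat) (z : algC).
Hypothesis zd : d.-primitive_root z.

Let d0 : (0 < d)%N. Proof. exact: prim_order_gt0 zd. Qed.

Lemma z1E m : (z ^+ m == 1) = (d %| m)%N.
Proof. by rewrite (prim_order_dvd zd). Qed.

(* [1 - q^m] is a unit at [z] times a power of the uniformizer [1 - q^d]. *)
Lemma qX_val m : (0 < m)%N ->
  exists2 a, a != 0 & evalsto z ((1 - qq ^+ m) / (1 - qq ^+ d) ^+ (d %| m)%N) a.
Proof.
move=> m0; case: (boolP (d %| m)%N) => [dm|ndm]; last first.
  exists (1 - z ^+ m); first by rewrite subr_eq0 eq_sym z1E.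
  by rewrite expr0 divr1; apply: evB; [exact: ev1|exact: ev_qX].
exists (m %/ d)%:R; first by rewrite pnatr_eq0 -lt0n divn_gt0 // dvdn_leq.
have -> : (1 - qq ^+ m) / (1 - qq ^+ d) ^+ true = geo (qq ^+ d) (m %/ d).
  rewrite expr1 -[X in qq ^+ X](divnK dm) mulnC exprM -geoM1 mulrC mulKf //.
  by rewrite subr_eq0 eq_sym qqX_neq1.
by rewrite -geo1; apply: ev_geo; rewrite -(prim_expr_order zd); exact: ev_qX.
Qed.

Lemma prod_qX_val (s : seq nat) : all (leq 1) s ->
  exists2 a, a != 0 &
    evalsto z (\prod_(m <- s) (1 - qq ^+ m) / (1 - qq ^+ d) ^+ (count (dvdn d) s)) a.
Proof.
elim: s => [|m s IH] /=.
  by exists 1; rewrite ?oner_neq0 // big_nil expr0 divr1; exact: ev1.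
move=> /andP[/qX_val[a a0 ea] /IH[b b0 eb]]; exists (a * b); first exact: mulf_neq0.
rewrite big_cons exprD invfM mulrACA; exact: evM.
Qed.

Lemma prod_qX_ratio (s t : seq nat) : all (leq 1) s -> all (leq 1) t ->
  (count (dvdn d) t <= count (dvdn d) s)%N ->
  exists2 f, regular z f &
   \prod_(m <- s) (1 - qq ^+ m) / \prod_(m <- t) (1 - qq ^+ m) =
   (1 - qq ^+ d) ^+ (count (dvdn d) s - count (dvdn d) t) * f.
Proof.
move=> /prod_qX_val[a a0 ea] /prod_qX_val[b b0 eb] le.
have p0 : 1 - qq ^+ d != 0 by rewrite subr_eq0 eq_sym qqX_neq1.
exists (\prod_(m <- s) (1 - qq ^+ m) / (1 - qq ^+ d) ^+ count (dvdn d) s /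
  (\prod_(m <- t) (1 - qq ^+ m) / (1 - qq ^+ d) ^+ count (dvdn d) t)).
  by exists (a / b); apply: ev_div.
set u := \prod_(m <- t) _; set v := \prod_(m <- s) _; set p := 1 - qq ^+ d in p0 *.
rewrite invf_div; set cs := count _ s in le *; set ct := count _ t in le *.
have -> : p ^+ cs = p ^+ (cs - ct) * p ^+ ct by rewrite -exprD subnK.
have x0 := expf_neq0 (cs - ct) p0; have y0 := expf_neq0 ct p0.
rewrite invfM -[LHS]mul1r -[X in X * _ = _](mulfV x0) -[X in X * _ = _]mulr1.
by rewrite -[X in _ * X * _ = _](mulfV y0); ring.
Qed.

End Root.

Lemma count_double g k : odd g ->
  count (fun i => g %| (2 * i).+2)%N (iota 0 k) = (k %/ g)%N.
Proof.
move=> og; have g0 : (0 < g)%N by case: (g) og.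
elim: k => [|k IH]; first by rewrite div0n.
rewrite -[X in iota 0 X]addn1 iotaD count_cat IH /= addn0 divnS // addnC add0n;
  congr (nat_of_bool _ + _)%N.
have -> : ((2 * k).+2 = 2 * k.+1)%N by lia.
by rewrite Gauss_dvdr // coprime_sym coprime2n.
Qed.

(** As [2(i + g./2 + 1) = 2i+1+g] and [g] is odd, [g] divides [2i+1] exactly when it divides
    [i + g./2 + 1]. *)
Lemma count_odd g k : odd g ->
  count (fun i => g %| (2 * i).+1)%N (iota 0 k) = ((k + g./2) %/ g)%N.
Proof.
move=> og; have g0 : (0 < g)%N by case: (g) og.
have gE : (g = (2 * g./2).+1)%N by have := odd_double_half g; rewrite og; lia.
elim: k => [|k IH]; first by rewrite divn_small //; lia.
rewrite -[X in iota 0 X]addn1 iotaD count_cat IH /= addn0 addSn divnS // [LHS]addnC add0n;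
  congr (nat_of_bool _ + _)%N.
 have co : coprime g 2 by rewrite coprime_sym coprime2n.
rewrite -(Gauss_dvdr (k + g./2).+1 co).
have -> : (2 * (k + g./2).+1 = (2 * k).+1 + g)%N by lia.
by rewrite dvdn_addl.
Qed.

(** * Regularity and vanishing of the sums at a root of unity *)

Section RhoRegular.
Variables (d s : nat) (z : algC).
Hypothesis zd : d.-primitive_root z.
Hypothesis d_odd : odd d.
Hypothesis s0 : (0 < s)%N.

(** The order of [z^s]; [s = 1] serves the left side and [s = n] the right side. *)
Let g := (d %/ gcdn d s)%N.

Let d0 : (0 < d)%N. Proof. exact: prim_order_gt0 zd. Qed.

Lemma g_odd : odd g.
Proof. by apply: dvdn_odd d_odd; rewrite /g dvdn_div // dvdn_gcdl. Qed.

Lemma dvd_scale m : (d %| s * m)%N = (g %| m)%N.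
Proof.
have e0 : (0 < gcdn d s)%N by rewrite gcdn_gt0 d0.
rewrite -[X in (X %| _)%N](divnK (dvdn_gcdl d s)).
rewrite -[X in (_ %| X * _)%N](divnK (dvdn_gcdr d s)) mulnAC dvdn_pmul2r //.
rewrite Gauss_dvdr // /coprime -(eqn_pmul2r e0) muln_gcdl !divnK ?dvdn_gcdl ?dvdn_gcdr //.
by rewrite mul1n.
Qed.

Lemma zs_prim : g.-primitive_root (z ^+ s).
Proof. by rewrite /g gcdnC; exact: exp_prim_root. Qed.

(** Numerator and denominator may both vanish at [z], but the odd numbers up to [2k-1] contain at
    least as many multiples of [g] as the even numbers up to [2k]. *)
Lemma rho2_regular k : regular z (rho 2 (qq ^+ s) k).
Proof.
pose s1 := [seq (s * (2 * i).+1)%N | i <- iota 0 k].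
pose s2 := [seq (s * (2 * i).+2)%N | i <- iota 0 k].
have -> : rho 2 (qq ^+ s) k =
   (\prod_(m <- s1) (1 - qq ^+ m) / \prod_(m <- s2) (1 - qq ^+ m)) ^+ 2.
  rewrite /rho expr_div_n !big_map -!prodrXl -prodf_div.
  rewrite -[k in iota 0 k]subn0 -/(index_iota 0 k) big_mkord.
  by apply: eq_bigr => i _; rewrite !wpf2 -!exprM.
have [||| f [a fa] ->] := prod_qX_ratio d z zd s1 s2.
- by apply/allP => _ /mapP[i _ ->]; rewrite muln_gt0 s0.
- by apply/allP => _ /mapP[i _ ->]; rewrite muln_gt0 s0.
- rewrite !count_map.
  rewrite (eq_count (a2 := fun i => g %| (2 * i).+2)%N); last by move=> i /=; exact: dvd_scale.
  rewrite [X in (_ <= X)%N](eq_count (a2 := fun i => g %| (2 * i).+1)%N); last by move=> i /=;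
    exact: dvd_scale.
  rewrite count_odd ?count_double ?g_odd // leq_div2r //; lia.
- by eexists; apply: evX; apply: evM fa; apply: evX; apply: evB; [exact: ev1|exact: ev_qX].
Qed.

(** [|1 + w^2| <= 2 < c = |c w|]. So at integers [c > 2] no deformed denominator vanishes at a root
    of unity. *)
Lemma wpf_neq0 (c : nat) (w : algC) : (2 < c)%N -> `|w| = 1 -> wpf c%:R w != 0.
Proof.
move=> c2 w1; rewrite /wpf subr_eq0; apply: contraTneq c2 => E.
have : `|w * c%:R| <= 2.
  by rewrite -E (le_trans (ler_normD _ _)) // normrX w1 normr1 expr1n.
by rewrite normrM w1 mul1r normr_nat ler_nat -leqNgt.
Qed.

Lemma z_norm1 : `|z| = 1.
Proof.
apply/eqP; rewrite -(pexpr_eq1 d0 (normr_ge0 z)) -normrX.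
by rewrite (prim_expr_order zd) normr1.
Qed.

Lemma wpf_root_neq0 (c m : nat) : (1 < c)%N -> ~~ (g %| m)%N ->
  wpf c%:R ((z ^+ s) ^+ m) != 0.
Proof.
move=> c1 ndm; have [c2|c2] := ltnP 2 c.
  apply: wpf_neq0 => //; rewrite !normrX.
  by rewrite z_norm1 ?expr1n.
have -> : c = 2%N by lia.
by rewrite wpf2 expf_neq0 // subr_eq0 eq_sym (z1E g) // zs_prim.
Qed.

Lemma rho_regular (c : nat) k : (1 < c)%N -> regular z (rho c%:R (qq ^+ s) k).
Proof.
move=> c1; have [c2|c2] := ltnP 2 c; last first.
  by have -> : c = 2%N by [lia]; exact: rho2_regular.
exists (rho c%:R (z ^+ s) k); apply: ev_prod => i _.
apply: ev_div; first by rewrite wpf_neq0 // !normrX z_norm1 ?expr1n.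
all: by apply: ev_wpf; [exact: ev_nat | apply: evX; exact: ev_qX].
Qed.

Lemma regD f h : regular z f -> regular z h -> regular z (f + h).
Proof. by move=> [a fa] [b hb]; exists (a + b); exact: evD. Qed.
Lemma regM f h : regular z f -> regular z h -> regular z (f * h).
Proof. by move=> [a fa] [b hb]; exists (a * b); exact: evM. Qed.

Lemma wpsum_regular (c : nat) k : (1 < c)%N -> regular z (wpsum c%:R (qq ^+ s) k).
Proof.
move=> c1; elim: k => [|k [a IH]]; first by rewrite /wpsum big_ord0; exists 0; exact: ev0.
rewrite /wpsum big_ord_recr /=; apply: regD; first by exists a.
apply: regM; last by apply: regM; apply: rho_regular.
by eexists; apply: ev_geo; exact: ev_qX.
Qed.

Variable M : nat.
Hypothesis M0 : (0 < M)%N.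
Hypothesis gE : g = (2 * M).+1.

Let zg : (z ^+ s) ^+ g = 1.
Proof. exact: prim_expr_order zs_prim. Qed.

Let ev_xX m l : evalsto z ((qq ^+ s) ^+ (2 * (g * l) + m)%N) ((z ^+ s) ^+ m).
Proof.
have -> : (z ^+ s) ^+ m = (z ^+ s) ^+ (2 * (g * l) + m).
  by rewrite exprD mulnCA exprM zg expr1n mul1r.
by apply: evX; exact: ev_qX.
Qed.

(** The exponents move by [2 g l], which [z^s] does not see. Inside a block the denominators have
    exponents [2(k+1)] with [k+1 < g], not divisible by the odd [g]. *)
Lemma rho_block (c l k : nat) u : (1 < c)%N -> (k < g)%N ->
  evalsto z (rho c%:R (qq ^+ s) (g * l)) u ->
  evalsto z (rho c%:R (qq ^+ s) (g * l + k)) (u * rho c%:R (z ^+ s) k).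
Proof.
move=> c1 kg eu; elim: k kg => [|k IH] kg; first by rewrite addn0 rho0 mulr1.
rewrite addnS !rhoS [u * _]mulrA; apply: evM; first by apply: IH; exact: ltnW.
apply: ev_div.
- apply: wpf_root_neq0 => //; have -> : ((2 * k).+2 = 2 * k.+1)%N by lia.
  rewrite Gauss_dvdr ?coprimen2 ?g_odd //; apply: contraL kg => /dvdn_leq; lia.
- apply: ev_wpf; first exact: ev_nat.
  have -> : ((2 * (g * l + k)).+1 = 2 * (g * l) + (2 * k).+1)%N by lia.
  exact: ev_xX.
- apply: ev_wpf; first exact: ev_nat.
  have -> : ((2 * (g * l + k)).+2 = 2 * (g * l) + (2 * k).+2)%N by lia.
  exact: ev_xX.
Qed.

Lemma wpsum_split {F : fieldType} (y x : F) a b : wpsum y x (a + b) =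
  wpsum y x a + \sum_(k < b) geo x (4 * (a + k)).+1 * (rho 2 x (a + k) * rho y x (a + k)).
Proof. by rewrite /wpsum big_split_ord. Qed.

Lemma block_ev0 (c l j : nat) : (1 < c)%N -> (M < j <= g)%N ->
  evalsto z (\sum_(k < j) geo (qq ^+ s) (4 * (g * l + k)).+1 *
    (rho 2 (qq ^+ s) (g * l + k) * rho c%:R (qq ^+ s) (g * l + k))) 0.
Proof.
move=> c1 /andP[Mj jg].
have [u eu] := rho_regular 2 (g * l) isT.
have [v ev] := rho_regular c (g * l) c1.
have zn1 m : ~~ (g %| m)%N -> (z ^+ s) ^+ m != 1 by rewrite (z1E g) // zs_prim.
have wn0 m : ~~ (g %| m)%N -> wpf c%:R ((z ^+ s) ^+ m) != 0 by exact: wpf_root_neq0.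
(* At [z] the block becomes [u * v] times the initial sum over [k < j], zero by [residue_sum]
   because its terms past [M] vanish. *)
suff -> : 0 = \sum_(k < j) geo (z ^+ s) (4 * k).+1 *
    (u * rho 2 (z ^+ s) k * (v * rho c%:R (z ^+ s) k)).
  apply: ev_sum => k _; apply: evM; last first.
    have kg : (k < g)%N := leq_trans (ltn_ord k) jg.
    by apply: evM; [exact: (rho_block 2) | exact: rho_block].
  have z1 : 1 - z ^+ s != 0.
    by rewrite subr_eq0 eq_sym -[z ^+ s]expr1 zn1 // gE gtnNdvd //; lia.
  have q1 : 1 - qq ^+ s != 0 by rewrite subr_eq0 eq_sym qqX_neq1.
  have -> : geo (qq ^+ s) (4 * (g * l + k)).+1 = 
     (1 - (qq ^+ s) ^+ (4 * (g * l + k)).+1) / (1 - qq ^+ s).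
    by rewrite -geoM1 mulrC mulKf.
  have -> : geo (z ^+ s) (4 * k).+1 = (1 - (z ^+ s) ^+ (4 * k).+1) / (1 - z ^+ s).
    by rewrite -geoM1 mulrC mulKf.
  apply: ev_div => //; last by apply: evB; [exact: ev1 | exact: ev_qX].
  apply: evB; first exact: ev1.
  have -> : ((4 * (g * l + k)).+1 = 2 * (g * (2 * l)) + (4 * k).+1)%N by lia.
  exact: ev_xX.
transitivity (u * v * wpsum c%:R (z ^+ s) j).
  rewrite (residue_sum_full _ _ M) //; last by rewrite -gE.
  rewrite residue_sum ?mulr0 -?gE // pnatr_eq0 //.
by rewrite mulr_sumr; apply: eq_bigr => k _; ring.
Qed.

Lemma wpsum_blocks_ev0 (c l : nat) : (1 < c)%N ->
  evalsto z (wpsum c%:R (qq ^+ s) (g * l)) 0.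
Proof.
move=> c1; elim: l => [|l IH]; first by rewrite muln0 /wpsum big_ord0; exact: ev0.
rewrite mulnS addnC wpsum_split -[X in evalsto _ _ X]addr0; apply: evD => //.
by apply: block_ev0 => //; rewrite leqnn gE; lia.
Qed.

Lemma wpsum_half_ev0 (c l : nat) : (1 < c)%N ->
  evalsto z (wpsum c%:R (qq ^+ s) (g * l + M.+1)) 0.
Proof.
move=> c1; rewrite wpsum_split -[X in evalsto _ _ X]addr0; apply: evD;
  first exact: wpsum_blocks_ev0.
by apply: block_ev0 => //; rewrite leqnn gE; lia.
Qed.

End RhoRegular.

(* For odd [T], [trunc true T = (T + 1) / 2] is the number of terms of the half-range sum. *)
Definition trunc (half : bool) (T : nat) : nat := if half then T./2.+1 else T.

(** That [d] does not divide [s] means [g > 1], so there are terms to cancel in each block. *)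
Lemma wpsum_trunc_ev0 d s z half (c T : nat) :
  d.-primitive_root z -> odd d -> (0 < s)%N -> (1 < c)%N -> odd T ->
  ~~ (d %| s)%N -> (d %| s * T)%N ->
  evalsto z (wpsum c%:R (qq ^+ s) (trunc half T)) 0.
Proof.
move=> zd od s0 c1 oT nds.
rewrite (dvd_scale _ _ _ zd) => /dvdnP[L TE].
have og := g_odd d s od.
set g := (d %/ gcdn d s)%N in TE og.
have gM : g = (2 * g./2).+1 by have := odd_double_half g; rewrite og; lia.
have M0 : (0 < g./2)%N.
  rewrite lt0n; apply: contraNneq nds => g0.
  have := dvd_scale d s z zd 1; rewrite muln1 -/g gM g0; lia.
rewrite /trunc; case: half; last by rewrite TE mulnC; apply: wpsum_blocks_ev0 M0 gM _ _ _.
have oL : odd L by move: oT; rewrite TE oddM => /andP[].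
have LE : L = (2 * L./2).+1 by have := odd_double_half L; rewrite oL; lia.
(* With [T = g L] and [L] odd, the half range consists of [(L-1)/2] full blocks and the first
   [(g+1)/2] terms of the next. *)
have -> : T./2.+1 = (g * L./2 + g./2.+1)%N.
  rewrite TE LE {1 3}gM;
    have -> : ((2 * L./2).+1 * (2 * g./2).+1 = (L./2 * (2 * g./2).+1 + g./2).*2.+1)%N by nia.
  rewrite /= uphalf_double; nia.
exact: wpsum_half_ev0 M0 gM _ _ _.
Qed.

(** * Clearing the denominators in [y] *)

Definition pevalsto (z : algC) (N : {poly RF}) (n : {poly algC}) : Prop :=
  forall i, evalsto z N`_i n`_i.
Definition pregular (z : algC) (N : {poly RF}) : Prop := exists n, pevalsto z N n.

Lemma horner_step {F : fieldType} (p H : {poly F}) (a c : F) :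
  p = H * ('X - a%:P) + (p.[a])%:P ->
  p * 'X + c%:P = (H * 'X + (p.[a])%:P) * ('X - a%:P) + ((p * 'X + c%:P).[a])%:P.
Proof.
rewrite hornerD hornerMX hornerC polyCD polyCM; move: (p.[a])%:P => b ->; ring.
Qed.

Definition wpfP {F : fieldType} (u : F) : {poly F} := (1 + u ^+ 2)%:P - u%:P * 'X.

Lemma wpfPE {F : fieldType} (u y : F) : (wpfP u).[y] = wpf y u.
Proof. by rewrite /wpfP hornerD hornerN hornerM !hornerC hornerX. Qed.

(** One denominator for both sums: the exponents [s(2i+2)] of the sum in [q^s] are among the even
    ones. *)
Definition denomP {F : fieldType} (q : F) (K : nat) : {poly F} :=
  \prod_(i < K) wpfP (q ^+ (2 * i).+2).

(* The cofactor in [denomP q K] of the denominator of [rho y (q ^+ s) k], whose factors are those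
   of index [s * (i + 1) - 1], [i < k]. *)
Definition codenomP {F : fieldType} (q : F) (s k K : nat) : {poly F} :=
  (\prod_(j < k) \prod_(i < s.-1) wpfP (q ^+ (2 * (s * j + i)).+2)) *
  \prod_(i < K - s * k) wpfP (q ^+ (2 * (s * k + i)).+2).

Definition rhoP {F : fieldType} (q : F) (s k K : nat) : {poly F} :=
  \prod_(i < k) wpfP (q ^+ (s * (2 * i).+1)) * codenomP q s k K.

Lemma denomP_split {F : fieldType} (q : F) s k K : (0 < s)%N -> (s * k <= K)%N ->
  denomP q K = \prod_(i < k) wpfP ((q ^+ s) ^+ (2 * i).+2) * codenomP q s k K.
Proof.
case: s => // s _ /subnKC KE; rewrite -{1}KE /denomP big_split_ord /codenomP /= mulrA.
congr (_ * _); elim: k {KE} => [|k IH]; first by rewrite muln0 !big_ord0 mulr1.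
rewrite mulnS addnC big_split_ord IH !big_ord_recr /=.
rewrite -exprM; have -> : (s.+1 * (2 * k).+2 = (2 * (s.+1 * k + s)).+2)%N by lia.
by rewrite [X in _ * X = _]mulrC mulrACA.
Qed.

Lemma denomPE {F : fieldType} (q y : F) K :
  (denomP q K).[y] = \prod_(i < K) wpf y (q ^+ (2 * i).+2).
Proof. by rewrite horner_prod; apply: eq_bigr => i _; rewrite wpfPE. Qed.

Lemma rhoPE {F : fieldType} (q y : F) s k K : (0 < s)%N -> (s * k <= K)%N ->
  (denomP q K).[y] != 0 -> (rhoP q s k K).[y] = (denomP q K).[y] * rho y (q ^+ s) k.
Proof.
move=> s0 sk; rewrite (denomP_split _ _ _ _ s0 sk) /rhoP !hornerM mulf_eq0 negb_or.
move=> /andP[V0 _]; rewrite /rho prodf_div.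
have -> : \prod_(i < k) wpf y ((q ^+ s) ^+ (2 * i).+1) =
  (\prod_(i < k) wpfP (q ^+ (s * (2 * i).+1))).[y].
  by rewrite horner_prod; apply: eq_bigr => i _; rewrite wpfPE exprM.
have E : \prod_(i < k) wpf y ((q ^+ s) ^+ (2 * i).+2) =
  (\prod_(i < k) wpfP ((q ^+ s) ^+ (2 * i).+2)).[y].
  by rewrite horner_prod; apply: eq_bigr => i _; rewrite wpfPE.
by rewrite E [RHS]mulrC [RHS]mulrA divfK.
Qed.

(** Only the denominators in [y] are cleared: [rho 2] stays in the coefficients, where it is regular
    by [rho2_regular]. *)
Definition wpsumP {F : fieldType} (q : F) (s m K : nat) : {poly F} :=
  \sum_(k < m) (geo (q ^+ s) (4 * k).+1 * rho 2 (q ^+ s) k)%:P * rhoP q s k K.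

Lemma wpsumPE {F : fieldType} (q y : F) s m K : (0 < s)%N -> (s * m.-1 <= K)%N ->
  (denomP q K).[y] != 0 ->
  (wpsumP q s m K).[y] = (denomP q K).[y] * wpsum y (q ^+ s) m.
Proof.
move=> s0 sm y0; rewrite /wpsumP horner_sum /wpsum mulr_sumr; apply: eq_bigr => -[k km] _ /=.
rewrite hornerM hornerC rhoPE //; first by rewrite mulrCA !mulrA.
by apply: leq_trans sm; rewrite leq_pmul2l //; lia.
Qed.

(** * Polynomials in [y] with regular coefficients *)

Section PolyPlace.
Variable z : algC.

Lemma pevalsto_uniq N m n : pevalsto z N m -> pevalsto z N n -> m = n.
Proof. by move=> Nm Nn; apply/polyP => i; apply: ev_uniq (Nm i) (Nn i). Qed.

Lemma pevalD M N m n : pevalsto z M m -> pevalsto z N n -> pevalsto z (M + N) (m + n).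
Proof. by move=> Mm Nn i; rewrite !coefD; apply: evD. Qed.

Lemma pevalM M N m n : pevalsto z M m -> pevalsto z N n -> pevalsto z (M * N) (m * n).
Proof. by move=> Mm Nn i; rewrite !coefM; apply: ev_sum => j _; apply: evM. Qed.

Lemma pevalC f a : evalsto z f a -> pevalsto z f%:P a%:P.
Proof. by move=> fa i; rewrite !coefC; case: eqP => // _; exact: ev0. Qed.

Lemma pevalX : pevalsto z 'X 'X.
Proof. by move=> i; rewrite !coefX; exact: ev_nat. Qed.

Lemma pregD M N : pregular z M -> pregular z N -> pregular z (M + N).
Proof. by move=> [m Mm] [n Nn]; exists (m + n); exact: pevalD. Qed.

Lemma pregM M N : pregular z M -> pregular z N -> pregular z (M * N).
Proof. by move=> [m Mm] [n Nn]; exists (m * n); exact: pevalM. Qed.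

Lemma pregC f : regular z f -> pregular z f%:P.
Proof. by move=> [a fa]; exists a%:P; exact: pevalC. Qed.

Lemma preg1 : pregular z 1.
Proof. by rewrite -polyC1; apply: pregC; exists 1; exact: ev1. Qed.

Lemma preg_prod I (r : seq I) (P : pred I) F :
  (forall i, P i -> pregular z (F i)) -> pregular z (\prod_(i <- r | P i) F i).
Proof.
by move=> H; apply: big_ind => //; [exact: preg1 | exact: pregM].
Qed.

Lemma peval_horner N n f a : pevalsto z N n -> evalsto z f a -> evalsto z N.[f] n.[a].
Proof.
move=> Nn fa.
rewrite (horner_coef_wide _ (leq_maxl (size N) (size n))).
rewrite (horner_coef_wide _ (leq_maxr (size N) (size n))).
by apply: ev_sum => i _; apply: evM => //; exact: evX.
Qed.

Lemma preg_horner N f : pregular z N -> regular z f -> regular z N.[f].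
Proof. by move=> [n Nn] [a fa]; exists n.[a]; exact: peval_horner. Qed.

(** Synthetic division by the monic [X - a] uses only sums and products of [a] and the coefficients,
    so regularity is kept. *)
Lemma preg_factor a N : regular z a -> pregular z N ->
  exists2 H, pregular z H & N = H * ('X - a%:P) + (N.[a])%:P.
Proof.
move=> ra; elim/poly_ind: N => [|p c IH] rN.
  by exists 0; [apply: pregC; exists 0; exact: ev0 | rewrite horner0 mul0r addr0].
have rp : pregular z p.
  have [n Nn] := rN; exists (drop_poly 1 n) => i.
  have := Nn i.+1; rewrite coef_drop_poly addn1 coefD coefMX coefC /=.
  by rewrite addr0.
have [H rH pE] := IH rp.
exists (H * 'X + (p.[a])%:P).
  apply: pregD; last by apply: pregC; exact: preg_horner.
  by apply: pregM => //; exists 'X; exact: pevalX.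
exact: horner_step.
Qed.

(** The roots are distinct before reduction, though perhaps not after it. They are divided out one
    at a time; a zero reduction passes to the quotient because [X - b] is not a zero divisor. *)
Lemma roots_factor (s : seq RF) N : pevalsto z N 0 ->
  (forall a, a \in s -> regular z a) -> uniq s -> all (root N) s ->
  exists2 H, pevalsto z H 0 & N = H * \prod_(a <- s) ('X - a%:P).
Proof.
elim: s N => [|a s IH] N N0 rs /=; first by exists N; rewrite // big_nil mulr1.
move=> /andP[as_ us] /andP[/eqP Na Ns].
have ra : regular z a by apply: rs; rewrite mem_head.
have [H [h Hh] NE] := preg_factor _ _ ra (ex_intro _ _ N0).
rewrite Na polyC0 addr0 in NE.
have H0 : pevalsto z H 0.
  have [b ab] := ra.
  suff <- : h = 0 by [].
  apply/eqP; have : h * ('X - b%:P) == 0.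
    apply/eqP/(@pevalsto_uniq N) => //; rewrite NE; apply: pevalM => //.
    by move=> i; rewrite !coefB !coefX !coefC; apply: evB; [exact: ev_nat|case: eqP => // _;
      exact: ev0].
  by rewrite mulf_eq0 polyXsubC_eq0 orbF.
have [||| G G0 GE] := IH H H0.
- by move=> b bs; apply: rs; rewrite inE bs orbT.
- by [].
- apply/allP => b bs; have := allP Ns b bs; rewrite NE rootM => /orP[//|].
  by rewrite root_XsubC => /eqP ba; move: bs; rewrite ba (negbTE as_).
by exists G => //; rewrite big_cons NE {1}GE mulrA mulrAC.
Qed.

(** A nonzero reduction would have the [size n] distinct roots 3, 4, and so on, more than its
    degree. *)
Lemma peval_inf0 N n : pevalsto z N n ->
  (forall c : nat, (2 < c)%N -> evalsto z N.[c%:R] 0) -> n = 0.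
Proof.
move=> Nn H; apply/eqP/negPn/negP => n0.
have := @max_poly_roots _ n [seq c%:R | c <- iota 3 (size n)] n0.
rewrite size_map size_iota ltnn => F; suff: false by []; apply: F.
  apply/allP => _ /mapP[c + ->]; rewrite mem_iota => /andP[c2 _].
  by apply/eqP; apply: ev_uniq (H c c2); apply: peval_horner => //; exact: ev_nat.
by rewrite map_inj_uniq ?iota_uniq // => i j /eqP; rewrite eqr_nat => /eqP.
Qed.

Lemma wpfP_regular u : regular z u -> pregular z (wpfP u).
Proof.
move=> [a ua]; exists ((1 + a ^+ 2)%:P - a%:P * 'X) => i.
rewrite !coefB; apply: evB; first by apply: pevalC; apply: evD; [exact: ev1|exact: evX].
by apply: pevalM; [exact: pevalC|exact: pevalX].
Qed.

Lemma wpfP_qX_regular m : pregular z (wpfP (qq ^+ m)).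
Proof. by apply: wpfP_regular; eexists; exact: ev_qX. Qed.

Lemma codenomP_regular s k K : pregular z (codenomP qq s k K).
Proof.
by apply: pregM; apply: preg_prod => *; [apply: preg_prod => *|]; exact: wpfP_qX_regular.
Qed.

Lemma wpsumP_regular d s m K : d.-primitive_root z -> odd d -> (0 < s)%N ->
  pregular z (wpsumP qq s m K).
Proof.
move=> zd od s0; apply: big_ind.
- by rewrite -polyC0; apply: pregC; exists 0; exact: ev0.
- exact: pregD.
move=> k _; apply: pregM.
  apply: pregC; apply: regM; last exact: (rho2_regular d).
  by eexists; apply: ev_geo; exact: ev_qX.
apply: pregM; last exact: codenomP_regular.
by apply: preg_prod => i _; exact: wpfP_qX_regular.
Qed.

End PolyPlace.

(** * The difference of the two sides *)

Section Difference.
Context {F : fieldType} (q : F).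
Variables (n : nat) (half : bool) (T' : nat).

Definition wpdiff (y : F) : F := wpsum y q (trunc half (n * T')) -
  q ^- (n.-1 %/ 2) * geo q n * wpsum y (q ^+ n) (trunc half T').

Definition wpdiffP : {poly F} := let K := (trunc half (n * T')).-1 in
  wpsumP q 1 (trunc half (n * T')) K -
  (q ^- (n.-1 %/ 2) * geo q n)%:P * wpsumP q n (trunc half T') K.

(** For odd [n], the exponent is odd, hence a node for the sum in [q], and an odd multiple of [n],
    hence a node for the sum in [q^n]. *)
Definition node (j : nat) : F :=
  q ^+ ((2 * j).+1 * n) + (q ^+ ((2 * j).+1 * n))^-1.

Hypothesis q0 : q != 0.
Hypothesis qX1 : forall m, (0 < m)%N -> q ^+ m != 1.
Hypothesis n_odd : odd n.
Hypothesis T'_odd : odd T'.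

Let n0 : (0 < n)%N. Proof. by case: n n_odd. Qed.
Let nE : (n = (2 * (n.-1 %/ 2)).+1)%N.
Proof. by have := odd_double_half n; rewrite n_odd divn2; case: n n_odd => // m /=;
  rewrite uphalf_half; lia. Qed.
Let T'E : T' = (2 * T'./2).+1.
Proof. by have := odd_double_half T'; rewrite T'_odd; lia. Qed.

Lemma trunc_scale : (n * (trunc half T').-1 <= (trunc half (n * T')).-1)%N.
Proof.
rewrite /trunc; case: half => /=; last by nia.
by rewrite geq_half_double -muln2; have := T'E; nia.
Qed.

Lemma wpdiffPE y : (denomP q (trunc half (n * T')).-1).[y] != 0 ->
  wpdiffP.[y] = (denomP q (trunc half (n * T')).-1).[y] * wpdiff y.
Proof.
move=> y0; rewrite /wpdiffP hornerD hornerN hornerM hornerC.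
rewrite (wpsumPE q y 1) //; last by rewrite mul1n.
rewrite (wpsumPE q y n) //; last exact: trunc_scale.
by rewrite expr1 mulrCA -mulrBr.
Qed.

(** Both sums have closed forms, with [M = n j + (n-1)/2] in base [q] and [M = j] in base [q^n].
    They agree by [[(2j+1) n] = [n] [2j+1]_{q^n}]. *)
Lemma wpdiff_node j : (j < trunc half T')%N -> wpdiff (node j) = 0.
Proof.
move=> jJ; set h := (n.-1 %/ 2)%N.
have qXn m : (0 < m)%N -> (q ^+ n) ^+ m != 1 by move=> m0; rewrite -exprM qX1 // muln_gt0 n0.
have mE : ((2 * j).+1 * n = (2 * (n * j + h)).+1)%N by rewrite nE -/h; lia.
have KE : trunc half (n * T') = (trunc half (n * T')).-1.+1.
  rewrite prednK // /trunc; case: half => //; lia.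
have KE' : trunc half T' = (trunc half T').-1.+1 by rewrite prednK //; lia.
have jK : (n * j + h <= (trunc half (n * T')).-1)%N.
  move: jJ; rewrite /trunc; case: half => /= jJ.
    rewrite geq_half_double -muln2; have := T'E; have := nE; rewrite -/h; nia.
  nia.
rewrite /wpdiff KE KE'.
have -> : node j = q ^+ (2 * (n * j + h)).+1 + (q ^+ (2 * (n * j + h)).+1)^-1.
  by rewrite /node mE.
rewrite (wpsum_node q q0 qX1 _ _ jK) -mE.
have -> : q ^+ ((2 * j).+1 * n) = (q ^+ n) ^+ (2 * j).+1 by rewrite mulnC exprM.
rewrite (wpsum_node (q ^+ n) (expf_neq0 n q0) qXn); last lia.
rewrite -/h exprD invfM -exprM.
have q1 : 1 - q != 0 by rewrite subr_eq0 eq_sym -[q]expr1 qX1.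
have qn1 : 1 - q ^+ n != 0 by rewrite subr_eq0 eq_sym qX1.
have -> : geo q ((2 * j).+1 * n) = geo q n * geo (q ^+ n) (2 * j).+1.
  by apply: (mulfI q1); rewrite mulrA !geoM1 -exprM mulnC.
by rewrite [q ^- _ * q ^- _]mulrC -!mulrA [geo q n * (_ * _)]mulrCA subrr.
Qed.

Lemma node_denom_neq0 j K : (denomP q K).[node j] != 0.
Proof.
rewrite denomPE; apply/prodf_neq0 => i _; rewrite /node wpf_node ?expf_neq0 //.
rewrite !mulf_neq0 ?invr_neq0 ?expf_neq0 //.
  by rewrite -exprD qX1' // addn_gt0.
(* The exponent of the node is odd, that of the denominator even. *)
rewrite qX_sub //; apply/eqP => /(congr1 odd); rewrite oddM n_odd /= oddM /=.
by rewrite oddM.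
Qed.

Lemma two_denom_neq0 K : (denomP q K).[2] != 0.
Proof.
by rewrite denomPE; apply/prodf_neq0 => i _; rewrite wpf2 expf_neq0 // qX1'.
Qed.

(** [wpf] at [u = q^((2i+1)n)] vanishes at node [i] and at no node of another index. *)
Lemma node_inj : injective node.
Proof.
move=> i j E; apply/eqP/negPn/negP => ij.
have v0 k : q ^+ ((2 * k).+1 * n) != 0 by rewrite expf_neq0.
have : wpf (node i) (q ^+ ((2 * i).+1 * n)) = 0.
  by rewrite /node wpf_node // subrr mulr0 mul0r.
rewrite E /node wpf_node // => /eqP; apply/negP.
rewrite !mulf_neq0 ?invr_neq0 //; first by rewrite -exprD qX1' // addn_gt0 muln_gt0 n0.
by rewrite qX_sub // eqn_pmul2r // eqSS eqn_pmul2l // eq_sym.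
Qed.

Lemma two_sub_node j : 2 - node j =
  - (q ^+ ((2 * j).+1 * n))^-1 * (1 - q ^+ ((2 * j).+1 * n)) ^+ 2.
Proof.
rewrite /node; move: (expf_neq0 ((2 * j).+1 * n) q0); set v := q ^+ _ => v0.
by field.
Qed.

End Difference.

(** * The cube of [Phi_d] for [d = n^t] *)

Lemma half_mul_odd a b : odd b -> ((a * b)./2 = b./2 * a + a./2)%N.
Proof.
move=> ob; rewrite -{1}(odd_double_half b) ob mulnDr muln1 -doubleMr halfD odd_double andbF add0n.
by rewrite doubleK addnC mulnC.
Qed.

(* One more factor [Phi_d] comes from the nodes [(2i+1) n] than is lost in the denominators
   [1 - q^(2i+2)]; both are squared in the end. *)
Lemma count_excess n half r t : (1 < n)%N -> odd n -> (0 < t <= r)%N ->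
  let T' := (n ^ r.-1)%N in let d := (n ^ t)%N in
  (count (dvdn d) [seq (2 * i).+2 | i <- iota 0 (trunc half (n * T')).-1] <
   count (dvdn d) [seq (2 * i).+1 * n | i <- iota 0 (trunc half T')])%N.
Proof.
move=> n1 no /andP[t0 tr]; set T' := (n ^ r.-1)%N; set d := (n ^ t)%N; cbv zeta; rewrite !count_map.
have od : odd d by rewrite oddX no orbT.
pose d1 := (n ^ t.-1)%N; pose e := (n ^ (r - t))%N.
have dE : d = (d1 * n)%N by rewrite /d /d1 -expnSr prednK.
have od1 : odd d1 by rewrite oddX no orbT.
have oe : odd e by rewrite oddX no orbT.
have TE : T' = (d1 * e)%N by rewrite /T' /d1 /e -expnD; congr (_ ^ _)%N; lia.
have n0 : (0 < n)%N by lia.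
have -> : count (preim (fun i => (2 * i).+2) (dvdn d)) (iota 0 (trunc half (n * T')).-1) =
  ((trunc half (n * T')).-1 %/ d)%N by rewrite -count_double.
have -> : count (preim (fun i => (2 * i).+1 * n)%N (dvdn d)) (iota 0 (trunc half T')) =
    ((trunc half T' + d1./2) %/ d1)%N.
  rewrite -count_odd //; apply: eq_count => i /=.
  by rewrite dE dvdn_pmul2r.
have d10 : (0 < d1)%N by rewrite expn_gt0 n0.
have d0 : (0 < d)%N by rewrite expn_gt0 n0.
have dE1 : d1 = (2 * d1./2).+1 by have := odd_double_half d1; rewrite od1; lia.
have dE2 : d = (2 * d./2).+1 by have := odd_double_half d; rewrite od; lia.
have nT : (n * T' = d * e)%N by rewrite TE dE; lia.
(* For the half range the two counts are [e./2] and [e./2 + 1]; for the full range they are [e - 1]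
   and at least [e]. *)
rewrite nT TE /trunc; case: half.
  rewrite /= !half_mul_odd // divnMDl // (divn_small (m := d./2)); last by lia.
  have -> : ((e./2 * d1 + d1./2).+1 + d1./2 = e./2.+1 * d1)%N by lia.
  by rewrite mulnK // addn0.
rewrite ltn_divLR // (leq_trans (n := (e * d)%N)) //.
  by rewrite mulnC prednK // muln_gt0 d0; lia.
rewrite leq_mul2r; apply/orP; right.
by rewrite leq_divRL // mulnC leq_addr.
Qed.

Lemma prim_root_neq0 d (z : algC) : d.-primitive_root z -> z != 0.
Proof. by move=> zd; rewrite -normr_eq0 (z_norm1 d) // oner_eq0. Qed.

(** On the right, if [d] does not divide [n] the sum vanishes at [z]; otherwise [[n]] does, and the
    sum is regular. *)
Lemma wpdiff_ev0 d z n half T' (c : nat) : d.-primitive_root z -> (1 < d)%N ->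
  odd n -> odd T' -> (d %| n * T')%N -> (1 < c)%N ->
  evalsto z (wpdiff qq n half T' c%:R) 0.
Proof.
move=> zd d1 no To dT c1.
have n0 : (0 < n)%N by case: n no {dT}.
have od : odd d by apply: dvdn_odd dT _; rewrite oddM no.
rewrite /wpdiff -[X in evalsto _ _ X]subr0; apply: evB.
  rewrite -[qq]expr1; apply: (wpsum_trunc_ev0 d) => //.
  - by rewrite oddM no.
  - by rewrite dvdn1; lia.
  - by rewrite mul1n.
have eh : evalsto z (qq ^- (n.-1 %/ 2)) (z ^- (n.-1 %/ 2)).
  by apply: evV (ev_qX _ _); rewrite expf_neq0 // (prim_root_neq0 d z zd).
have [dn|ndn] := boolP (d %| n)%N; last first.
  rewrite -[X in evalsto _ _ X](mulr0 (z ^- (n.-1 %/ 2) * geo z n)).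
  apply: evM; last exact: (wpsum_trunc_ev0 d).
  by apply: evM => //; apply: ev_geo; rewrite -[z]expr1; exact: (ev_qX z 1).
have [a ea] := wpsum_regular d n z zd od n0 c (trunc half T') c1.
rewrite -[X in evalsto _ _ X](mul0r a) -[X in evalsto _ _ (X * _)](mulr0 (z ^- (n.-1 %/ 2))).
apply: evM => //; apply: evM => //.
suff <- : geo z n = 0 by apply: ev_geo; rewrite -[z]expr1; exact: (ev_qX z 1).
have z1 : 1 - z != 0 by rewrite subr_eq0 eq_sym -[z]expr1 (z1E d) // dvdn1; lia.
by apply: (mulfI z1); rewrite geoM1 mulr0; apply/eqP; rewrite subr_eq0 eq_sym (z1E d).
Qed.

Lemma horner_prod_XsubC {F : fieldType} (s : seq F) x :
  (\prod_(a <- s) ('X - a%:P)).[x] = \prod_(a <- s) (x - a).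
Proof. by rewrite horner_prod; apply: eq_bigr => a _; rewrite hornerXsubC. Qed.

(** At [y = 2] the denominator and, up to units, the divided factors become squares, so the excess
    in [count_excess] counts twice. *)
Lemma wpdiff_two {F : fieldType} (q : F) n half T' H :
  q != 0 -> (forall m, (0 < m)%N -> q ^+ m != 1) -> odd n -> odd T' ->
  let sd := [seq (2 * i).+2 | i <- iota 0 (trunc half (n * T')).-1] in
  let sn := [seq (2 * i).+1 * n | i <- iota 0 (trunc half T')]%N in
  wpdiffP q n half T' =
    H * \prod_(a <- [seq node q n j | j <- iota 0 (trunc half T')]) ('X - a%:P) ->
  wpdiff q n half T' 2 = H.[2] * \prod_(m <- sn) (- (q ^+ m)^-1) *
    (\prod_(m <- sn) (1 - q ^+ m) / \prod_(m <- sd) (1 - q ^+ m)) ^+ 2.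
Proof.
move=> q0 qX1 no oT sd sn HE.
have D2 := two_denom_neq0 q qX1 (trunc half (n * T')).-1.
have := wpdiffPE q n half T' q0 no oT 2 D2.
rewrite HE hornerM horner_prod_XsubC big_map => E.
have DE : (denomP q (trunc half (n * T')).-1).[2] = (\prod_(m <- sd) (1 - q ^+ m)) ^+ 2.
  rewrite denomPE -prodrXl big_map -[X in iota 0 X]subn0 -/(index_iota 0 _) big_mkord.
  by apply: eq_bigr => i _; rewrite wpf2.
have nE : \prod_(j <- iota 0 (trunc half T')) (2 - node q n j) =
    \prod_(m <- sn) (- (q ^+ m)^-1) * (\prod_(m <- sn) (1 - q ^+ m)) ^+ 2.
  rewrite -prodrXl -big_split big_map /=.
  by apply: eq_bigr => j _; exact: two_sub_node.
rewrite DE in D2 E; apply: (mulfI D2); rewrite -E expr_div_n [RHS]mulrC.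
by rewrite nE -[RHS]mulrA divfK // mulrA.
Qed.

Lemma sq_step {F : fieldType} (h p f : F) e :
  h * (p ^+ e.+1 * f) ^+ 2 = p ^+ 2 * (h * (p ^+ e * f) ^+ 2).
Proof. by rewrite [p ^+ e.+1]exprS; ring. Qed.

(** The square comes from the excess of factors. [G] vanishes at [z] because it contains [H.[2]],
    where the quotient [H] reduces to zero; this is the third [Phi_d]. *)
Lemma wpdiff_cube n r t z half : (1 < n)%N -> odd n -> (0 < t <= r)%N ->
  (n ^ t).-primitive_root z ->
  exists2 G, evalsto z G 0 &
    wpdiff qq n half (n ^ r.-1) 2 = (1 - qq ^+ (n ^ t)) ^+ 2 * G.
Proof.
move=> n1 no tr zd.
have := count_excess n half r t n1 no tr; cbv zeta.
set T' := (n ^ r.-1)%N; set d := (n ^ t)%N in zd *.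
set K := (trunc half (n * T')).-1; set J := trunc half T'.
set sd := [seq _ | i <- iota 0 K]; set sn := [seq _ | i <- iota 0 J] => lt.
have n0 : (0 < n)%N by lia.
have od : odd d by rewrite oddX no orbT.
have oT : odd T' by rewrite oddX no orbT.
have d1 : (1 < d)%N by rewrite -(exp1n t) ltn_exp2r //; lia.
have dT : (d %| n * T')%N.
  by rewrite /T' -expnS dvdn_exp2l //; lia.
have z0 : z != 0 by rewrite (prim_root_neq0 d z zd).
have rP : pregular z (wpdiffP qq n half T').
  apply: pregD; first exact: (wpsumP_regular z d).
  rewrite -mulNr -polyCN; apply: pregM; last exact: (wpsumP_regular z d).
  apply: pregC; eexists; apply: evN; apply: evM.
    by apply: evV (ev_qX _ _); rewrite expf_neq0.
  by apply: ev_geo; exact: (ev_qX z 1).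
have P0 : pevalsto z (wpdiffP qq n half T') 0.
  have [N eN] := rP; suff <- : N = 0 by [].
  apply: (peval_inf0 z _ _ eN) => c c2.
  have dc : exists2 a, a != 0 & evalsto z (denomP qq K).[c%:R] a.
    rewrite denomPE; exists (\prod_(i < K) wpf c%:R (z ^+ (2 * i).+2)).
      by apply/prodf_neq0 => i _; rewrite wpf_neq0 // normrX (z_norm1 d) // expr1n.
    by apply: ev_prod => i _; apply: ev_wpf; [exact: ev_nat|exact: ev_qX].
  have [a a0 ea] := dc.
  have d0 : (denomP qq K).[c%:R] != 0.
    by apply: contraNneq a0 => E; apply/eqP; apply: ev_uniq ea _; rewrite E; exact: ev0.
  rewrite (wpdiffPE qq n half T' qq_neq0 no oT _ d0) -[X in evalsto _ _ X](mulr0 a).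
  by apply: evM ea _; apply: (wpdiff_ev0 d) => //; lia.
have [||| H H0 HE] := roots_factor z [seq node qq n j | j <- iota 0 J] _ P0.
- move=> _ /mapP[j _ ->]; eexists; apply: evD; first exact: ev_qX.
  by apply: evV (ev_qX _ _); rewrite expf_neq0.
- rewrite map_inj_uniq ?iota_uniq //; exact: (node_inj qq n qq_neq0 qqX_neq1 no).
- apply/allP => _ /mapP[j + ->]; rewrite mem_iota add0n => jJ; apply/rootP.
  have dn := node_denom_neq0 qq n qq_neq0 qqX_neq1 no j K.
  by rewrite (wpdiffPE qq n half T' qq_neq0 no oT _ dn) (wpdiff_node qq n half T' qq_neq0 qqX_neq1
    no oT _ jJ) mulr0.
have [||| f rf fE] := prod_qX_ratio d z zd sn sd.
- by apply/allP => _ /mapP[i _ ->]; rewrite muln_gt0 n0.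
- by apply/allP => _ /mapP[i _ ->].
- exact: ltnW.
have e0 : (0 < count (dvdn d) sn - count (dvdn d) sd)%N by rewrite subn_gt0.
rewrite (wpdiff_two qq n half T' H qq_neq0 qqX_neq1 no oT HE) -/sn -/sd fE.
set e := (_ - _)%N in e0 *; set U := \prod_(m <- sn) _.
have rU : regular z U.
  rewrite /U; apply: big_ind => [||m _]; first by exists 1; exact: ev1.
    exact: regM.
  by eexists; apply: evN; apply: evV (ev_qX _ _); rewrite expf_neq0.
have rp : regular z (1 - qq ^+ d) by eexists; apply: evB; [exact: ev1 | exact: ev_qX].
move: rU rp rf => [u eu] [p ep] [b eb].
exists (H.[2] * U * ((1 - qq ^+ d) ^+ e.-1 * f) ^+ 2).
  rewrite -[X in evalsto _ _ X](mul0r ((p ^+ e.-1 * b) ^+ 2)).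
  apply: evM; last by apply: evX; apply: evM => //; exact: evX.
  rewrite -[X in evalsto _ _ X](mul0r u); apply: evM => //.
  by have := peval_horner _ _ _ _ _ H0 (ev_nat z 2); rewrite horner0.
by rewrite -{1}(prednK e0) sq_step.
Qed.

(** * Cyclotomic polynomials, and divisibility from local to global *)

Lemma pQtoC_inj : injective (map_poly (ratr : rat -> algC)).
Proof. exact: map_poly_inj. Qed.

(** [Phi_d] is the minimal polynomial of [z] over the rationals. *)
Lemma pev_eq0 d z p : d.-primitive_root z -> (pev z p == 0) = (PhiQ d %| p).
Proof.
move=> zd; have [m [mE mm] mP] := minCpolyP z.
suff -> : PhiQ d = m by rewrite -mP.
apply: pQtoC_inj; rewrite -mE (minCpoly_cyclotomic zd) -(Cintr_Cyclotomic zd) /PhiQ.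
rewrite -map_poly_comp; apply: eq_map_poly => x /=; exact: ratr_int.
Qed.

(** A common root of [D] and [Phi_d] is again a primitive [d]-th root, so by [pev_eq0] [Phi_d]
    divides [D], which then vanishes at [z] too. *)
Lemma pev_coprime d z D : d.-primitive_root z -> pev z D != 0 -> coprimep D (PhiQ d).
Proof.
move=> zd Dn; rewrite -(coprimep_map (ratr : {rmorphism rat -> algC})).
apply/Pdiv.ClosedField.coprimepP => x Dx; apply/negP => Px; move: Dn; rewrite (pev_eq0 _ _ _ zd).
have xd : d.-primitive_root x.
  rewrite -(root_cyclotomic zd) -(Cintr_Cyclotomic zd).
  move: Px; rewrite /PhiQ -map_poly_comp => /eqP E; apply/rootP; rewrite -E.
  by congr (_.[x]); apply: eq_map_poly => y /=; rewrite ratr_int.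
by rewrite -(pev_eq0 _ _ _ xd) /pev; rewrite (rootP Dx) eqxx.
Qed.

Lemma PhiQ_coprime d e : (0 < d)%N -> (0 < e)%N -> d != e -> coprimep (PhiQ d) (PhiQ e).
Proof.
move=> d0 e0 de; have [z ze] := C_prim_root_exists e0; have [w wd] := C_prim_root_exists d0.
apply: (pev_coprime _ _ _ ze); apply: contraNneq de => E.
have /eqP : pev z (PhiQ d) = 0 := E.
rewrite /pev /PhiQ -map_poly_comp => zP.
have zd : d.-primitive_root z.
  rewrite -(root_cyclotomic wd) -(Cintr_Cyclotomic wd); apply/rootP; rewrite -[RHS](eqP zP).
  by congr (_.[z]); apply: eq_map_poly => y /=; rewrite ratr_int.
by rewrite eqn_dvd -(z1E _ _ zd) -(z1E _ _ ze) (prim_expr_order zd) (prim_expr_order ze) !eqxx.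
Qed.

Lemma prod_PhiQ T : (0 < T)%N -> \prod_(d <- divisors T) PhiQ d = 'X^T - 1.
Proof.
move=> T0; have := congr1 (map_poly (intr : int -> rat)) (prod_Cyclotomic T0).
by rewrite rmorph_prod rmorphB rmorph1 /= map_polyXn.
Qed.

Lemma qintP_prod T : (0 < T)%N -> qintP T = \prod_(d <- divisors T | d != 1%N) PhiQ d.
Proof.
move=> T0; have P1 : PhiQ 1 = 'X - 1.
  by have := prod_PhiQ 1 isT; rewrite big_seq1.
apply: (@mulfI _ ('X - 1)); first by rewrite -polyC1 polyXsubC_eq0.
by rewrite /qintP -subrX1 -prod_PhiQ // (bigD1_seq 1%N) /= ?divisors_uniq ?P1 // -dvdn_divisors.
Qed.

Lemma coprimep_prod (I : eqType) (s : seq I) (D : {poly rat}) (F : I -> {poly rat}) :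
  (forall i, i \in s -> coprimep D (F i)) -> coprimep D (\prod_(i <- s) F i).
Proof.
move=> H; rewrite big_seq; apply: (big_ind (coprimep D)) => //; first exact: coprimep1.
by move=> p q; rewrite coprimepMr => -> ->.
Qed.

Lemma prod_dvdp (I : eqType) (s : seq I) (N : {poly rat}) (F : I -> {poly rat}) :
  uniq s -> {in s &, forall i j, i != j -> coprimep (F i) (F j)} ->
  (forall i, i \in s -> F i %| N) -> \prod_(i <- s) F i %| N.
Proof.
elim: s => [|i s IH] /=; first by rewrite big_nil dvd1p.
move=> /andP[is_ us] co dv; rewrite big_cons Gauss_dvdp.
  rewrite dv ?mem_head // IH // => [j k js ks|j js].
    by apply: co; rewrite inE ?js ?ks orbT.
  by apply: dv; rewrite inE js orbT.
apply: coprimep_prod => j js; apply: co; rewrite ?mem_head ?inE ?js ?orbT //.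
by apply: contraNneq is_ => ->.
Qed.

Section Reduced.
Variables (N D : {poly rat}).
Hypothesis D0 : D != 0.
Hypothesis co : coprimep D N.

(** Write [G = A / B] with [Phi_d] dividing [A] and [B] prime to it. In [N B = (1 - X^d)^k A D], the
    [k] factors [1 - X^d] and [A] each contribute one [Phi_d]. *)
Lemma reduced_local d z k (G : RF) : d.-primitive_root z -> (0 < d)%N ->
  evalsto z G 0 -> polyF N / polyF D = (1 - qq ^+ d) ^+ k * G ->
  PhiQ d ^+ k.+1 %| N /\ coprimep D (PhiQ d).
Proof.
move=> zd d0 [A [B [B0 -> /eqP]]].
rewrite eq_sym mulf_eq0 invr_eq0 (negbTE B0) orbF (pev_eq0 d) // => PA E.
have XP : PhiQ d %| 1 - 'X^d.
  rewrite -opprB dvdpNr -prod_PhiQ // (bigD1_seq d) ?divisors_uniq ?divisors_id //=.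
  exact: dvdp_mulr.
have BP := pev_coprime _ _ _ zd B0.
have qE : (1 - qq ^+ d) ^+ k = polyF ((1 - 'X^d) ^+ k).
  by rewrite /polyF tofracXn tofracB tofrac1 tofracXn.
have NB : N * B = (1 - 'X^d) ^+ k * A * D.
  apply/eqP; rewrite -subr_eq0 -polyF_eq0 polyFD polyFN !polyFM -qE subr_eq0.
  move: E; rewrite mulrA => /eqP; rewrite eqr_div ?polyF_eq0 //.
  by apply: contraNneq B0 => ->; rewrite pev0.
split.
  have c : coprimep (PhiQ d ^+ k.+1) B by rewrite coprimep_expl // coprimep_sym.
  by rewrite -(Gauss_dvdpl N c) NB dvdp_mulr // exprSr dvdp_mul // dvdp_exp2r.
(* As [N / D] is in lowest terms, [D] divides [B]. *)
apply: coprimep_dvdr BP; rewrite -(Gauss_dvdpr B co) NB; exact: dvdp_mull.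
Qed.
End Reduced.

(** The congruence asks for one fraction serving all factors of the modulus. In lowest terms, it can
    be tested at each [Phi_d] separately. *)
Lemma qcongr_local (f : RF) (n r : nat) : (1 < n)%N -> (0 < r)%N ->
  (forall d z, (d %| n ^ r)%N -> (1 < d)%N -> d.-primitive_root z -> evalsto z f 0) ->
  (forall t z, (0 < t <= r)%N -> (n ^ t).-primitive_root z ->
     exists2 G, evalsto z G 0 & f = (1 - qq ^+ (n ^ t)) ^+ 2 * G) ->
  exists N D : {poly rat}, [/\ D != 0,
    coprimep D (qintP (n ^ r) * \prod_(1 <= j < r.+1) PhiQ (n ^ j) ^+ 2),
    qintP (n ^ r) * \prod_(1 <= j < r.+1) PhiQ (n ^ j) ^+ 2 %| N &
    f = polyF N / polyF D].
Proof.
move=> n1 r0 H1 H3; set T := (n ^ r)%N.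
have n0 : (0 < n)%N by lia.
have T0 : (0 < T)%N by rewrite expn_gt0 n0.
have T1 : (1 < T)%N by rewrite -(exp1n r) ltn_exp2r.
(* [H1] at a primitive [T]-th root supplies a fraction, which is then divided by its gcd. *)
have [N [D [D0 co fE]]] : exists N D, [/\ D != 0, coprimep D N & f = polyF N / polyF D].
  have [w wT] := C_prim_root_exists T0.
  have [A [B [B0 fE _]]] := H1 T w (dvdnn _) T1 wT.
  have Bn0 : B != 0 by apply: contraNneq B0 => ->; rewrite pev0.
  exists (A %/ gcdp B A), (B %/ gcdp B A); split.
  - by rewrite dvdp_div_eq0 // dvdp_gcdl.
  - by rewrite coprimep_div_gcd // Bn0.
  have g0 : gcdp B A != 0 by rewrite gcdp_eq0 (negbTE Bn0).
  have := divpK (dvdp_gcdr B A); have := divpK (dvdp_gcdl B A).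
  rewrite fE; set g := gcdp B A in g0 *; set B' := B %/ g; set A' := A %/ g.
  by move=> <- <-; rewrite !polyFM -mulf_div mulfV ?mulr1 // polyF_eq0.
exists N, D.
pose L := [seq d <- divisors T | d != 1%N].
pose pows := [seq (n ^ j)%N | j <- index_iota 1 r.+1].
have Lin d : (d \in L) = (1 < d)%N && (d %| T)%N.
  rewrite mem_filter -dvdn_divisors //; case: (boolP (d %| T)%N); rewrite ?andbF // => dT.
  by have := dvdn_gt0 T0 dT; lia.
have upows : uniq pows.
  by rewrite map_inj_uniq ?iota_uniq // => i j; exact: expnI.
have powsL d : d \in pows -> d \in L.
  move=> /mapP[j]; rewrite mem_index_iota => /andP[j0 jr] ->.
  by rewrite Lin -(exp1n j) ltn_exp2r // n1 dvdn_exp2l.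
(* The modulus is a product over the divisors [d > 1] of [n^r], with exponent 3 if [d] is a power of
   [n] and 1 otherwise. *)
have ME : qintP T * \prod_(1 <= j < r.+1) PhiQ (n ^ j) ^+ 2 =
    \prod_(d <- L) PhiQ d ^+ (1 + 2 * (d \in pows)).
  under [RHS]eq_bigr do rewrite exprD expr1.
  rewrite [RHS]big_split /= qintP_prod // -big_filter -/L; congr (_ * _).
  transitivity (\prod_(d <- pows) PhiQ d ^+ 2); first by rewrite big_map.
  transitivity (\prod_(d <- [seq d <- L | d \in pows]) PhiQ d ^+ 2).
    apply: perm_big; apply: uniq_perm => //; first by rewrite !filter_uniq ?divisors_uniq.
    by move=> d; rewrite [RHS]mem_filter; case: (boolP (d \in pows)) => // /powsL ->.
  by rewrite big_filter big_mkcond /=; apply: eq_bigr => d _; case: (d \in pows).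
have loc d : d \in L -> PhiQ d ^+ (1 + 2 * (d \in pows)) %| N /\ coprimep D (PhiQ d).
  rewrite Lin => /andP[d1 dT]; have d0 : (0 < d)%N by lia.
  have [/mapP[t]|_] := boolP (d \in pows).
    rewrite mem_index_iota ltnS => tr dE.
    have [w wd] := C_prim_root_exists d0.
    have [|G G0 fG] := H3 t w tr; first by rewrite -dE.
    by apply: (reduced_local _ _ D0 co _ w _ G) => //; rewrite -fE fG dE.
  have [w wd] := C_prim_root_exists d0.
  apply: (reduced_local _ _ D0 co _ w 0 f wd d0 (H1 d w dT d1 wd)).
  by rewrite expr0 mul1r.
rewrite ME; split => //.
  apply: coprimep_prod => d dL; apply: coprimep_expr; exact: (loc d dL).2.
apply: prod_dvdp; first by rewrite filter_uniq ?divisors_uniq.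
  move=> i j; rewrite !Lin => /andP[i1 _] /andP[j1 _] ij.
  by apply: coprimep_expl; apply: coprimep_expr; apply: PhiQ_coprime => //; lia.
by move=> d dL; exact: (loc d dL).1.
Qed.

(** * Return to the q-shifted factorials *)

Lemma summand_rho {F : fieldType} (x : F) (k : nat) :
  (\prod_(i < k) (1 - x * (x ^+ 2) ^+ i)) ^+ 4 /
    (\prod_(i < k) (1 - x ^+ 2 * (x ^+ 2) ^+ i)) ^+ 4 = rho 2 x k * rho 2 x k.
Proof.
have -> : rho 2 x k = ((\prod_(i < k) (1 - x * (x ^+ 2) ^+ i)) /
    (\prod_(i < k) (1 - x ^+ 2 * (x ^+ 2) ^+ i))) ^+ 2.
  rewrite expr_div_n -!prodrXl -prodf_div; apply: eq_bigr => i _.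
  by rewrite !wpf2 -!exprM -!exprD -exprS.
by rewrite -exprD expr_div_n.
Qed.

Lemma wpsum_two (x : RF) m :
  \sum_(k < m) qint x (4 * k).+1 * (qpoch x (x ^+ 2) k ^+ 4 / qpoch (x ^+ 2) (x ^+ 2) k ^+ 4) =
  wpsum 2 x m.
Proof. by apply: eq_bigr => k _; rewrite -summand_rho. Qed.

Theorem theorem1p1 (n r : nat) :
  (1 < n)%N -> odd n -> (1 <= r)%N ->
  let M := qintP (n ^ r) * \prod_(1 <= j < r.+1) PhiQ (n ^ j) ^+ 2 in
  qcongr
    (\sum_(k < ((n ^ r).-1 %/ 2).+1)
       qint qq (4 * k).+1 * (qpoch qq (qq ^+ 2) k ^+ 4 / qpoch (qq ^+ 2) (qq ^+ 2) k ^+ 4))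
    (qq ^- ((n.-1) %/ 2) * qint qq n *
     \sum_(k < ((n ^ r.-1).-1 %/ 2).+1)
       qint (qq ^+ n) (4 * k).+1 *
       (qpoch (qq ^+ n) (qq ^+ (2 * n)) k ^+ 4 / qpoch (qq ^+ (2 * n)) (qq ^+ (2 * n)) k ^+ 4))
    M
  /\
  qcongr
    (\sum_(k < n ^ r)
       qint qq (4 * k).+1 * (qpoch qq (qq ^+ 2) k ^+ 4 / qpoch (qq ^+ 2) (qq ^+ 2) k ^+ 4))
    (qq ^- ((n.-1) %/ 2) * qint qq n *
     \sum_(k < n ^ r.-1)
       qint (qq ^+ n) (4 * k).+1 *
       (qpoch (qq ^+ n) (qq ^+ (2 * n)) k ^+ 4 / qpoch (qq ^+ (2 * n)) (qq ^+ (2 * n)) k ^+ 4))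
    M.
Proof.
move=> n1 no r1 M.
have T'o : odd (n ^ r.-1) by rewrite oddX no orbT.
have nT : (n * n ^ r.-1 = n ^ r)%N by rewrite -expnS prednK.
(* The upper limits [(m-1)/2] are inclusive, whence the successor. *)
have half_trunc m : odd m -> (m.-1 %/ 2).+1 = trunc true m.
  by rewrite divn2 /trunc; case: m => // m /= om; rewrite uphalf_half (negbTE om).
have core half : qcongr (wpsum 2 qq (trunc half (n ^ r)))
    (qq ^- (n.-1 %/ 2) * qint qq n * wpsum 2 (qq ^+ n) (trunc half (n ^ r.-1))) M.
  (* The two sides differ by [wpdiff] at [y = 2]: single factors [Phi_d] come from [wpdiff_ev0],
     cubes from [wpdiff_cube]. *)
  rewrite -nT; apply: (qcongr_local (wpdiff qq n half (n ^ r.-1) 2)) => //.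
    move=> d z dT d1 zd; apply: (wpdiff_ev0 d z n half (n ^ r.-1) 2) => //.
    by rewrite nT.
  by move=> t z tr zd; exact: wpdiff_cube.
have -> : qq ^+ (2 * n) = (qq ^+ n) ^+ 2 by rewrite mulnC exprM.
rewrite !wpsum_two !half_trunc //; last by rewrite oddX no orbT.
by split; [exact: (core true) | exact: (core false)].
Qed.
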